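(* Let $\Omega\subset\mathbb{R}$ be a nonempty bounded open set, written as $\Omega=\bigcup_{n\in I}\,]a_n,b_n[$ with pairwise disjoint open intervals $]a_n,b_n[$, where $I=\mathbb{N}$ or $I=\{1,\dots,k\}$, and let $L=\max_{n\in I}(b_n-a_n)$. Let $f:[0,\infty[\to[0,\infty[$ be an increasing continuous function with $\lim_{s\to\infty}f(s)=\infty$ and $f(0)>0$. Consider, for $\lambda>0$, the problem $$-\left(\frac{u'}{|u'|}\right)'=\lambda f(u)\ \text{ in }\Omega,\qquad u=0\ \text{ on }\partial\Omega .$$ Set $\lambda^*=\frac{2}{Lf(0)}$. Then: (1) If $0<\lambda<\lambda^*$, there exist nontrivial nonnegative solutions. (2) If $\lambda=\lambda^*$, every solution vanishes on each interval $]a_n,b_n[$ whose length is $L$.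
   Context: ''Increasing'' means strictly increasing. The intervals $]a_n,b_n[$ are the connected components of $\Omega$. Since $f$ is defined on $[0,\infty[$, solutions are nonnegative functions. $BV(\Omega)$ is the space of $u\in L^1(\Omega)$ whose distributional derivative $u'=Du$ is a bounded Radon measure. $L^{1,\infty}(\Omega)$ is the space of measurable $g$ such that $k\,|\{|g|>k\}|\le C$ for all $k>0$, with $C$ independent of $k$. A function $u\in BV(\Omega)$ is a solution if $f(u)\in L^{1,\infty}(\Omega)$ and there is $\mathbf z\in L^\infty(\Omega)$ (the function associated with $u$) such that: (i) $\|\mathbf z\|_\infty\le1$; (ii) $-\mathbf z'=\lambda f(u)$ in $\mathcal D'(\Omega)$; (iii) $(\mathbf z,Du)=|Du|$ as measures in $\Omega$, where $(\mathbf z,Du)$ is the distribution $\langle(\mathbf z,Du),\varphi\rangle=-\int_\Omega u\varphi\,\mathbf z'-\int_\Omega u\,\mathbf z\,\varphi'$, $\varphi\in C_c^\infty(\Omega)$; (iv) $[\mathbf z,\nu]\in\operatorname{sign}(-u)$ on $\partial\Omega$, that is, at the endpoints of each component interval, with one-sided traces of $u$ and $\mathbf z$ taken from inside the interval and outward normal $\nu=-1$ at $a_n$, $\nu=+1$ at $b_n$. Here $\operatorname{sign}$ is the multivalued sign: $\operatorname{sign}(s)=\{s/|s|\}$ for $s\ne0$ and $\operatorname{sign}(0)=[-1,1]$. *)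

(* Defs.v *)
From mathcomp Require Import all_boot all_order all_algebra.
From mathcomp Require Import all_classical all_reals all_analysis.

Set Implicit Arguments.
Unset Strict Implicit.
Unset Printing Implicit Defensive.

Import Order.TTheory GRing.Theory Num.Theory.
Import numFieldNormedType.Exports.

Local Open Scope ring_scope.
Local Open Scope classical_set_scope.

(* Functions on [Omega] are total functions [R -> R] whose values outside
   [Omega] are irrelevant; elements of L^1, L^oo and BV are represented by
   measurable functions, and every condition on them is stated up to
   Lebesgue-null sets. *)

(* C_c^oo(Omega) *)
Definition test_function (R : realType) (Omega : set R) (phi : R -> R) : Prop :=
  [/\ forall (n : nat) (x : R), derivable phi^`(n) x 1,
      compact (closure [set x | phi x != 0]) &
      closure [set x | phi x != 0] `<=` Omega].

(* z' = g in D'(Omega), where g is a function *)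
Definition has_weak_derivative (R : realType) (Omega : set R) (z g : R -> R)
    : Prop :=
  [/\ locally_integrable Omega z, locally_integrable Omega g &
      forall phi, test_function Omega phi ->
        (\int[lebesgue_measure]_(x in Omega) (z x * derive1 phi x)) =
        - (\int[lebesgue_measure]_(x in Omega) (g x * phi x))].

(* Integral with respect to a charge, through its Jordan decomposition; it does
   not depend on the Hahn decomposition used. *)
Definition charge_Rintegral (R : realType)
    (nu : {charge set (measurableTypeR R) -> \bar R})
    (P N : set (measurableTypeR R)) (nuPN : hahn_decomposition nu P N)
    (D : set R) (phi : R -> R) : R :=
  (\int[jordan_pos nuPN]_(x in D) phi x)
  - (\int[jordan_neg nuPN]_(x in D) phi x).

(* Charges of the library are finite, so this says that the distributional
   derivative of u in Omega is the bounded signed measure nu restricted to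
   Omega. *)
Definition has_measure_derivative (R : realType) (Omega : set R) (u : R -> R)
    (nu : {charge set (measurableTypeR R) -> \bar R})
    (P N : set (measurableTypeR R)) (nuPN : hahn_decomposition nu P N) : Prop :=
  forall phi, test_function Omega phi ->
    (\int[lebesgue_measure]_(x in Omega) (u x * derive1 phi x)) =
    - charge_Rintegral nuPN Omega phi.

Definition weak_L1 (R : realType) (Omega : set R) (g : R -> R) : Prop :=
  measurable_fun Omega g /\
  exists C : R, forall k : R, 0 < k ->
    (k%:E * lebesgue_measure (Omega `&` [set x | (k < `|g x|)%R]) <= C%:E)%E.

(* <(z, Du), phi>, where z' is the function dz *)
Definition pairing (R : realType) (Omega : set R) (u z dz phi : R -> R) : R :=
  - (\int[lebesgue_measure]_(x in Omega) (u x * phi x * dz x))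
  - (\int[lebesgue_measure]_(x in Omega) (u x * z x * derive1 phi x)).

(* One-sided traces in dimension one: c is the one-sided limit at the point
   of a good representative of v, that is, the essential one-sided limit. *)
Definition right_trace (R : realType) (v : R -> R) (a c : R) : Prop :=
  forall e : R, 0 < e -> exists2 d : R, 0 < d &
    {ae lebesgue_measure, forall x : R, a < x < a + d -> `|v x - c| < e}.

Definition left_trace (R : realType) (v : R -> R) (b c : R) : Prop :=
  forall e : R, 0 < e -> exists2 d : R, 0 < d &
    {ae lebesgue_measure, forall x : R, b - d < x < b -> `|v x - c| < e}.

Definition msign (R : realType) (s : R) : set R :=
  if s == 0 then `[-1, 1] else [set s / `|s|].

Definition boundary_condition (R : realType) (I : set nat) (a b : nat -> R)
    (u z : R -> R) : Prop :=
  forall n, I n ->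
    (exists c d : R, [/\ right_trace u (a n) c, right_trace z (a n) d &
                         msign (- c) (d * -1)]) /\
    (exists c d : R, [/\ left_trace u (b n) c, left_trace z (b n) d &
                         msign (- c) (d * 1)]).

(* Solutions of -(u'/|u'|)' = lam f(u) in Omega, u = 0 on the boundary, where
   the `]a n, b n[, for n in I, are the components of Omega.  Only the values
   of f on [0, +oo[ matter, since u >= 0.  Membership of u in BV(Omega) is its
   integrability together with the existence of Du; the latter comes with a
   Hahn decomposition, on which nothing depends, so that |Du| is the library's
   charge_variation. *)
Definition solution (R : realType) (Omega : set R) (I : set nat)
    (a b : nat -> R) (f : R -> R) (lam : R) (u : R -> R) : Prop :=
  {ae lebesgue_measure, forall x : R, Omega x -> 0 <= u x} /\
  lebesgue_measure.-integrable Omega (EFin \o u) /\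
  weak_L1 Omega (f \o u) /\
  exists (Du : {charge set (measurableTypeR R) -> \bar R})
         (P N : set (measurableTypeR R)) (DuPN : hahn_decomposition Du P N),
    has_measure_derivative Omega u DuPN /\
    exists z : R -> R,
      [/\ measurable_fun Omega z /\
          {ae lebesgue_measure, forall x : R, Omega x -> `|z x| <= 1},
          has_weak_derivative Omega z (fun x => - (lam * f (u x))),
          forall phi, test_function Omega phi ->
            pairing Omega u z (fun x => - (lam * f (u x))) phi =
            (\int[charge_variation DuPN]_(x in Omega) phi x) &
          boundary_condition I a b u z].

(* Main.v *)
(* Existence: let J be a longest component, and c > 0 with f c = 2 / (lam L).
   Take u = c on J and u = 0 elsewhere, so that Du = 0 in Omega, and z affine
   on each component, vanishing at its midpoint, with slope -lam f(u).  On J,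
   z runs from 1 to -1; on the other components |z| <= 1, which is enough
   because sign(0) = [-1,1].  (Making u nonzero on all components could violate
   f(u) in weak L^1.)

   Rigidity: z cannot decrease by more than 2, while z' = -lam f(u) with
   f(u) >= f(0) and lam f(0) L = 2 on an interval of length L; hence f(u) = f(0)
   a.e. there.  This is tested against unimodal bumps 0 <= phi <= 1, for which
   the integral of |phi'| is at most 2, approximating the indicator of the
   interval. *)

Require Import Defs.
From mathcomp Require Import all_boot all_order all_algebra.
From mathcomp Require Import all_classical all_reals all_analysis.
From mathcomp Require Import measurable_realfun ring lra.
Import Order.TTheory GRing.Theory Num.Theory.
Import numFieldNormedType.Exports.
Local Open Scope ring_scope.
Local Open Scope classical_set_scope.
Set Implicit Arguments.
Unset Strict Implicit.

(** * Smooth functions that are flat at the zeros of a polynomial *)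

Lemma expR_inv_le (R : realType) (t : R) (m : nat) : 0 < t ->
  expR (- t^-1) <= m.+1`!%:R * t ^+ m.+1.
Proof.
move=> t0; have t10 : 0 < t^-1 by rewrite invr_gt0.
(* The exponential of [t^-1] dominates the single term of degree [m.+1] of its series; inverting
   this bound gives the claim. *)
have := expR_ge1Dxn m (ltW t10); rewrite expRN => h.
have f0 : 0 < m.+1`!%:R :> R by rewrite ltr0n fact_gt0.
have h2 : t^-1 ^+ m.+1 / m.+1`!%:R <= expR t^-1.
  by apply: le_trans h; rewrite lerDr ler01.
rewrite -[leRHS]invrK lef_pV2 ?posrE ?expR_gt0 ?invr_gt0 ?mulr_gt0 ?exprn_gt0//.
by rewrite invfM mulrC -exprVn.
Qed.

(* With p = 1 and n = 0 this is exp(-1/q) on {q > 0}, extended by 0; the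
   parameters p and n make the family stable under derivation. *)
Definition flat (R : realType) (q p : {poly R}) (n : nat) (x : R) : R :=
  if 0 < q.[x] then p.[x] * q.[x]^-1 ^+ n * expR (- q.[x]^-1) else 0.

(** Differentiating [p * q^-n * exp(-1/q)] and putting everything over [q ^ (n+2)] leaves this
    polynomial as numerator. *)
Definition dflat (R : realType) (q p : {poly R}) (n : nat) : {poly R} :=
  p^`() * q ^+ 2 - (p * q^`() * q) *+ n + p * q^`().

(** The exponential beats every power of [q^-1]: bounding it by a multiple of [q ^ (n+2)] absorbs
    [q^-n] and leaves the factor [q ^ 2], which provides derivability at the zeros of [q]. *)
Lemma flat_le (R : realType) (q p : {poly R}) n (x : R) :
  `|flat q p n x| <= `|p.[x]| * (n.+2`!%:R * q.[x] ^+ 2).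
Proof.
rewrite /flat; case: ifPn => q0; last first.
  by rewrite normr0 mulr_ge0// mulr_ge0// sqr_ge0.
rewrite -mulrA normrM ler_wpM2l// ger0_norm; last first.
  by rewrite mulr_ge0// ?expR_ge0// exprn_ge0// invr_ge0 ltW.
rewrite exprVn ler_pdivrMl ?exprn_gt0// mulrCA -exprD addn2.
exact: expR_inv_le.
Qed.

(** The bound forces [f x = 0], and the difference quotient is then at most [K.[h + x] * |h|], which
    tends to 0. A polynomial [K] lets the bound hold on the whole line, without localization. *)
Lemma is_derive_quadratic_bound (R : realType) (f : R -> R) (K : {poly R}) (x : R) :
  (forall y, `|f y| <= K.[y] * (y - x) ^+ 2) -> is_derive x 1 f 0.
Proof.
move=> fK.
have fx0 : f x = 0.
  by apply/eqP; rewrite -normr_le0 (le_trans (fK x))// subrr expr0n mulr0.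
suff df : h^-1 *: (f (h *: 1 + x) - f x) @[h --> 0^'] --> (0 : R).
  by apply: DeriveDef; [apply/cvg_ex; exists 0|exact: cvg_lim].
apply/norm_cvg0P.
have cK : (fun h => K.[h + x] * `|h|) @ 0^' --> (0 : R).
  have : (fun h => K.[h + x] * `|h|) @ (0 : R) --> K.[0 + x] * `|0 : R|.
    apply: cvgM; last exact: norm_continuous.
    apply: (@continuous_comp _ _ _ (fun h : R => h + x) (horner K)) => /=.
      by apply: cvgD; [exact: cvg_id|exact: cvg_cst].
    exact: continuous_horner.
  rewrite normr0 mulr0 => ?; exact: cvg_within_filter.
apply: (squeeze_cvgr _ (cvg_cst (0:R)) cK).
near=> h.
have h0 : h != 0 by near: h; exact: nbhs_dnbhs_neq.
rewrite normr_ge0/= fx0 subr0 normrM normfV ler_pdivrMl ?normr_gt0//.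
rewrite (le_trans (fK _))// [h *: 1]mulr1 addrK.
by rewrite [leRHS]mulrCA -normrM -expr2 ger0_norm ?sqr_ge0.
Unshelve. all: by end_near. Qed.

Lemma is_derive_flat (R : realType) (q p : {poly R}) n (x : R) :
  is_derive x 1 (flat q p n) (flat q (dflat q p n) n.+2 x).
Proof.
have cq := @continuous_horner R q x.
rewrite {2}/flat; case: ltgtP => q0.
- have nq0 : q.[x] != 0 by rewrite gt_eqF.
  pose h (y : R) := p.[y] * q.[y]^-1 ^+ n * expR (- q.[y]^-1).
  apply: (@near_eq_is_derive _ _ _ h).
    near=> y; rewrite /flat /h ifT//.
    by near: y; exact: (cvgr_gt q.[x]).
  have dV : is_derive x 1 (fun y => (q.[y])^-1) (- q.[x] ^- 2 *: q^`().[x]).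
    have dq : derivable (horner q) x 1 by exact: derivable_horner.
    by apply: DeriveDef; [exact: derivableV|rewrite deriveV// derive_val].
  have dN : is_derive x 1 (fun y => - (q.[y])^-1) (- (- q.[x] ^- 2 *: q^`().[x])).
    exact: is_deriveN.
  have dE : is_derive x 1 (expR \o (fun y => - (q.[y])^-1))
     (- (- q.[x] ^- 2 *: q^`().[x]) * expR (- q.[x]^-1)).
    rewrite mulrC.
    exact: is_derive1_comp.
  have dX := is_deriveX n dV.
  have -> : h = horner p * (fun y => q.[y]^-1) ^+ n
                * (expR \o (fun y => - q.[y]^-1)).
    by apply/funext => y; rewrite /h !fctE.
  apply: (is_derive_eq (is_deriveM (is_deriveM (is_derive_poly p x) dX) dE)).
  rewrite (_ : (dflat q p n).[x] = p^`().[x] * q.[x] ^+ 2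
      - (p.[x] * q^`().[x] * q.[x]) *+ n + p.[x] * q^`().[x]); last first.
    by rewrite /dflat !(hornerE, hornerMn, horner_exp).
  have sE (c d : R) : c *: (d : R^o) = c * d by [].
  rewrite !fctE !sE/=.
  case: n {dX h} => [|n]; first by rewrite !mulr0n !expr0; field.
  by rewrite -[_ *+ n.+1]mulr_natr !exprS; move: (q.[x]^-1 ^+ n) => k; field.
- apply: near_eq_is_derive (is_derive_cst (0 : R) x 1).
  near=> y; rewrite /flat ifF//; apply/negbTE; rewrite -leNgt ltW//.
  by near: y; exact: (cvgr_lt q.[x]).
(* At a zero of [q] one has [q = r * (X - x)], so [flat_le] becomes a quadratic bound around [x].
   Replacing [|p|] by [p ^ 2 + 1] makes its coefficient a polynomial. *)
- have /factor_theorem[r qE] : root q x by apply/rootP.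
  apply: (@is_derive_quadratic_bound _ _ ((p^+2 + 1) * r^+2 *+ n.+2`!)) => y.
  apply: le_trans (flat_le _ _ _ _) _.
  have -> : ((p ^+ 2 + 1) * r ^+ 2 *+ n.+2`!).[y] =
      (p.[y] ^+ 2 + 1) * n.+2`!%:R * r.[y] ^+ 2.
    by rewrite hornerMn -mulr_natr mulrAC !(hornerE, horner_exp).
  rewrite qE hornerM hornerXsubC exprMn.
  have h : `|p.[y]| <= p.[y] ^+ 2 + 1.
    have := sqr_ge0 (`|p.[y]| - 1); rewrite sqrrB1 real_normK ?num_real//.
    have := normr_ge0 p.[y]; lra.
  move: (r.[y] ^+ 2) (sqr_ge0 r.[y]) ((y - x) ^+ 2) (sqr_ge0 (y - x)) => c c0 d d0.
  by rewrite -!mulrA ler_wpM2r// !mulr_ge0.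
Unshelve. all: by end_near. Qed.

Lemma derive1n_flat (R : realType) (q p : {poly R}) (n k : nat) :
  exists r m, (flat q p n)^`(k) = flat q r m.
Proof.
elim: k => [|k [r [m e]]]; first by exists p, n.
exists (dflat q r m), m.+2; rewrite derive1nS e.
by apply/funext => x; rewrite derive1E; have /@derive_val := is_derive_flat q r m x.
Qed.

Lemma derivable_derive1n_flat (R : realType) (q p : {poly R}) (n k : nat) (x : R) :
  derivable (flat q p n)^`(k) x 1.
Proof.
by have [r [m ->]] := derive1n_flat q p n k; have [] := is_derive_flat q r m x.
Qed.

(** * Smooth bumps approximating the indicator of an interval *)

Lemma continuous_derivable (R : realType) (f : R -> R) :
  (forall x, derivable f x 1) -> continuous f.
Proof. by move=> df x; exact/differentiable_continuous/derivable1_diffP. Qed.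

(** On []a, b[] and for [k > 0] this is [exp(-1 / (k (x - a) (b - x)))]; a large [k] brings it close
    to 1 inside the interval. *)
Definition smooth_bump (R : realType) (k a b : R) : R -> R :=
  flat (k *: (('X - a%:P) * (b%:P - 'X))) 1 0.

Lemma bumpE (R : realType) (k a b x : R) : smooth_bump k a b x =
  if 0 < k * ((x - a) * (b - x)) then expR (- (k * ((x - a) * (b - x)))^-1) else 0.
Proof. by rewrite /smooth_bump /flat !hornerE. Qed.

Lemma flat_bump_out (R : realType) (k a b x : R) (p : {poly R}) n :
  0 < k -> a < b -> ~~ (a < x < b) ->
  flat (k *: (('X - a%:P) * (b%:P - 'X))) p n x = 0.
Proof.
move=> k0 ab xab; rewrite /flat ifF//; apply/negbTE; 
  rewrite hornerZ hornerM hornerXsubC hornerD hornerN hornerC hornerX pmulr_rgt0//.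
apply: contra xab; apply: contraTT; rewrite negb_and -!leNgt => /orP[xa|bx].
- by rewrite mulr_le0_ge0 ?subr_le0 ?subr_ge0// (le_trans xa)// ltW.
- by rewrite mulr_ge0_le0 ?subr_le0 ?subr_ge0// (le_trans _ bx)// ltW.
Qed.

Lemma bump_out (R : realType) (k a b x : R) : 0 < k -> a < b ->
  ~~ (a < x < b) -> smooth_bump k a b x = 0.
Proof. exact: flat_bump_out. Qed.

Lemma bump_ge0 (R : realType) (k a b x : R) : 0 <= smooth_bump k a b x.
Proof. by rewrite bumpE; case: ifP => // _; rewrite expR_ge0. Qed.

Lemma bump_le1 (R : realType) (k a b x : R) : smooth_bump k a b x <= 1.
Proof.
rewrite bumpE; case: ifP => // h.
by rewrite -expR0 ler_expR oppr_le0 invr_ge0 ltW.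
Qed.

Lemma bump_test (R : realType) (Omega : set R) (k a b : R) : 0 < k -> a < b ->
  `[a, b] `<=` Omega -> test_function Omega (smooth_bump k a b).
Proof.
move=> k0 ab abO.
have cl : closure [set x | smooth_bump k a b x != 0] `<=` `[a, b].
  rewrite [X in _ `<=` X](closure_id _).1; last exact: itv_closed.
  apply: closureS => x /=; apply: contraR => xab.
  apply/eqP/bump_out => //; apply: contra xab => /andP[ax xb].
  by rewrite in_itv/= !ltW.
split; first by move=> n x; exact: derivable_derive1n_flat.
- apply: subclosed_compact cl; first exact: closed_closure.
  exact: segment_compact.
- exact: subset_trans abO.
Qed.


(** Unimodality: for [k > 0] the derivative has the sign of [a + b - 2x], hence changes sign only at
    the midpoint. For the numerator 1 and [n = 0], [dflat] reduces to the derivative of the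
    quadratic polynomial. *)
Lemma derive1_bump (R : realType) (k a b x : R) : exists2 c : R, 0 <= c &
  derive1 (smooth_bump k a b) x = c * (k * (a + b - x *+ 2)).
Proof.
set q := k *: (('X - a%:P) * (b%:P - 'X)).
have -> : derive1 (smooth_bump k a b) x = flat q (dflat q 1 0) 2 x.
  by rewrite derive1E; have /@derive_val := is_derive_flat q 1 0 x.
rewrite /flat; case: ifPn => q0; last by exists 0; rewrite ?mul0r.
exists (q.[x]^-1 ^+ 2 * expR (- q.[x]^-1)).
  by rewrite mulr_ge0 ?expR_ge0 ?sqr_ge0.
have -> : (dflat q 1 0).[x] = k * (a + b - x *+ 2).
  rewrite /dflat mulr0n derivC mul0r subr0 add0r mul1r /q derivZ derivM.
  by rewrite !derivB !derivC !derivX !hornerE; ring.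
by rewrite -mulrA mulrC.
Qed.

Lemma derive1_bump_out (R : realType) (k a b x : R) : 0 < k -> a < b ->
  ~~ (a < x < b) -> derive1 (smooth_bump k a b) x = 0.
Proof.
move=> k0 ab xab; rewrite derive1E.
have /@derive_val -> := is_derive_flat (k *: (('X - a%:P) * (b%:P - 'X))) 1 0 x.
exact: flat_bump_out.
Qed.

Lemma continuous_derive1_bump (R : realType) (k a b : R) :
  continuous (derive1 (smooth_bump k a b)).
Proof.
apply: continuous_derivable => x.
exact: (@derivable_derive1n_flat _ _ _ _ 1).
Qed.

(** The bump rises up to the midpoint [m] and falls afterwards, so by the fundamental theorem of
    calculus on each half the integral is [2 phi(m) - phi(a) - phi(b)], and [0 <= phi <= 1]. *)
Lemma bump_int (R : realType) (k a b : R) : 0 < k -> a < b ->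
  \int[lebesgue_measure]_(x in `[a, b]) `|derive1 (smooth_bump k a b) x| <= 2.
Proof.
move=> k0 ab.
set phi := smooth_bump k a b; set m := (a + b) / 2.
have dphi x : derivable phi x 1 by exact: (@derivable_derive1n_flat _ _ _ _ 0).
have cphi := continuous_derivable dphi.
have cd := @continuous_derive1_bump R k a b.
have FTC c d : c < d -> \int[lebesgue_measure]_(x in `[c, d]) derive1 phi x = phi d - phi c.
  move=> ltcd; rewrite -[RHS]/(fine ((phi d)%:E - (phi c)%:E)); congr fine.
  apply: continuous_FTC2; [exact: ltcd|exact: continuous_subspaceT| |by []].
  split; [by []|exact/cvg_at_right_filter/cphi|exact/cvg_at_left_filter/cphi].
have am : a < m by rewrite /m; lra.
have mb : m < b by rewrite /m; lra.
have cn : continuous (fun x => `|derive1 phi x|).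
  by move=> x; apply: continuous_comp; [exact: cd|exact: norm_continuous].
have ci (g : R -> R) c d : continuous g -> lebesgue_measure.-integrable `[c, d] (EFin \o g).
  by move=> cg; apply: continuous_compact_integrable;
    [exact: segment_compact|exact: continuous_subspaceT].
have -> : `[a, b]%classic = `[a, m] `|` `]m, b].
  by rewrite -itv_bndbnd_setU// bnd_simp ltW.
rewrite Rintegral_setU//; last 2 first.
- by rewrite -itv_bndbnd_setU ?bnd_simp 1?ltW//; exact: ci.
- apply/disj_setPS => x /= []; rewrite !in_itv/= => /andP[_ xm] /andP[mx _].
  by have := lt_le_trans mx xm; rewrite ltxx.
rewrite Rintegral_itv_obnd_cbnd; last first.
  by apply: integrableS (ci _ m b cn) => //; exact: subset_itv_oc_cc.
have -> : \int[lebesgue_measure]_(x in `[a, m]) `|derive1 phi x| = phi m - phi a.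
  rewrite -FTC//; apply: eq_Rintegral => x; rewrite inE/= in_itv/= => /andP[_ xm].
  rewrite ger0_norm// /phi; have [c c0 ->] := derive1_bump k a b x.
  by rewrite mulr_ge0// mulr_ge0 ?(ltW k0)//; move: xm; rewrite /m; lra.
have -> : \int[lebesgue_measure]_(x in `[m, b]) `|derive1 phi x| = phi m - phi b.
  have -> : phi m - phi b = -1 * (phi b - phi m) by rewrite mulN1r opprB.
  rewrite -FTC// -RintegralZl//; last exact: ci.
  apply: eq_Rintegral => x; rewrite inE/= in_itv/= => /andP[mx _].
  rewrite ler0_norm ?mulN1r// /phi; have [c c0 ->] := derive1_bump k a b x.
  rewrite mulr_ge0_le0// pmulr_rle0//; move: mx; rewrite /m; lra.
have := bump_le1 k a b m; rewrite -/phi.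
have := bump_ge0 k a b a; have := bump_ge0 k a b b; rewrite -/phi; lra.
Qed.

(** At distance at least [d] from both endpoints, [(x - a) (b - x) >= d ^ 2]. The scale [d ^- 3]
    then makes the exponent at least [- d], and [exp(- d) >= 1 - d]. *)
Lemma bump_ge (R : realType) (d a b x : R) : 0 < d ->
  a + d <= x <= b - d -> 1 - d <= smooth_bump (d ^- 3) a b x.
Proof.
move=> d0 /andP[ax xb]; have d3 : 0 < d ^- 3 by rewrite invr_gt0 exprn_gt0.
have h : d ^+ 2 <= (x - a) * (b - x).
  by rewrite expr2 ler_pM ?(ltW d0)//; lra.
have h1 : d^-1 <= d ^- 3 * ((x - a) * (b - x)).
  have -> : d^-1 = d ^- 3 * d ^+ 2 by field; rewrite gt_eqF.
  by rewrite ler_pM2l.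
have d1 : 0 < d^-1 by rewrite invr_gt0.
rewrite bumpE (lt_le_trans d1 h1); apply: le_trans (expR_ge1Dx _).
by rewrite lerD2l lerN2 -[leRHS]invrK lef_pV2 ?posrE// (lt_le_trans d1 h1).
Qed.

(** * Test functions and integration by parts *)

Lemma test_function_derivable (R : realType) (Omega : set R) (phi : R -> R) :
  test_function Omega phi -> forall x, derivable phi x 1.
Proof. by case=> d _ _ x; exact: (d 0%N x). Qed.

Lemma test_function_continuous (R : realType) (Omega : set R) (phi : R -> R) :
  test_function Omega phi -> continuous phi.
Proof. by move/test_function_derivable/continuous_derivable. Qed.

Lemma test_function_continuous_derive1 (R : realType) (Omega : set R)
    (phi : R -> R) : test_function Omega phi -> continuous (derive1 phi).
Proof. by case=> d _ _; apply: continuous_derivable => x; exact: (d 1%N). Qed.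

Lemma notin_support_eq0 (R : realType) (phi : R -> R) (x : R) :
  ~ closure [set x | phi x != 0] x -> phi x = 0.
Proof.
by move=> nK; apply: contra_notP nK => /eqP ?; exact: subset_closure.
Qed.

Lemma notin_support_derive1_eq0 (R : realType) (phi : R -> R) (x : R) :
  ~ closure [set x | phi x != 0] x -> derive1 phi x = 0.
Proof.
move=> nK; rewrite derive1E.
suff : is_derive x 1 phi 0 by case.
apply: near_eq_is_derive (is_derive_cst (0 : R) x 1).
have oK : open (~` closure [set x | phi x != 0]).
  exact/closed_openC/closed_closure.
apply: filterS (open_nbhs_nbhs (conj oK nK)) => y /= nKy.
by rewrite (notin_support_eq0 nKy).
Qed.

(** The product vanishes off [K], and on [K] it is an integrable function times a bounded one. *)
Lemma integrable_compact_support (R : realType) (Omega K : set R) (g psi : R -> R) :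
  locally_integrable Omega g -> continuous psi -> compact K -> K `<=` Omega ->
  (forall x, ~ K x -> psi x = 0) ->
  lebesgue_measure.-integrable Omega (fun x => (g x * psi x)%:E).
Proof.
move=> [mg oO ig] cpsi cK KO psi0.
have mK : measurable K := compact_measurable cK.
have mO : measurable Omega := open_measurable oO.
have -> : (fun x => (g x * psi x)%:E) = (fun x => (g x * psi x)%:E) \_ K.
  apply/funext => x; rewrite patchE; case: ifPn => // /negP.
  by rewrite inE => nK; rewrite psi0// mulr0.
apply/integrable_restrict => //; rewrite setIidr//.
have igK : lebesgue_measure.-integrable K (EFin \o g).
  apply/integrableP; split; last exact: ig.
  by apply/measurable_EFinP; apply: measurable_funS mg.
have [M [Mr hM]] : bounded_set (psi @` K).
  by apply: compact_bounded; apply: continuous_compact => //; exact: continuous_subspaceT.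
change (lebesgue_measure.-integrable K ((EFin \o g) \* (EFin \o psi))%E).
apply: integrableMl => //.
- by apply: measurable_funTS; exact: continuous_measurable_fun.
- by exists M; split => // N MN x Kx; apply: (hM N MN); exists x.
Qed.

Lemma continuous_locally_integrable (R : realType) (Omega : set R) (g : R -> R) :
  open Omega -> (forall x, Omega x -> {for x, continuous g}) ->
  locally_integrable Omega g.
Proof.
move=> oO cg; split => //.
  by apply: open_continuous_measurable_fun => // x /set_mem; exact: cg.
move=> K KO cK.
suff /integrableP[] : lebesgue_measure.-integrable K (EFin \o g) by [].
apply: continuous_compact_integrable => //.
by apply: continuous_in_subspaceT => x /set_mem /KO; exact: cg.
Qed.

(** A point outside [Omega] has a neighbourhood avoiding the closed set [K], on which the extension
    by zero is identically 0. *)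
Lemma is_derive_extension (R : realType) (Omega K : set R) (h dh : R -> R) :
  open Omega -> closed K -> K `<=` Omega ->
  (forall x, Omega x -> is_derive x 1 h (dh x)) ->
  (forall x, ~ K x -> h x = 0) -> (forall x, ~ K x -> dh x = 0) ->
  forall x : R, is_derive x 1 (h \_ Omega) ((dh \_ Omega) x).
Proof.
move=> oO cK KO dhO h0 dh0 x.
have [Ox|nOx] := pselect (Omega x).
  rewrite patchE mem_set//; apply: near_eq_is_derive (dhO x Ox).
  apply: filterS (open_nbhs_nbhs (conj oO Ox)) => y Oy.
  by rewrite patchE mem_set.
rewrite patchE memNset//.
have nK : (~` K) x by move/KO.
apply: near_eq_is_derive (is_derive_cst (0 : R) x 1).
apply: filterS (open_nbhs_nbhs (conj (closed_openC cK) nK)) => y nKy.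
by rewrite patchE; case: ifPn => // _; rewrite h0.
Qed.

Lemma continuous_extension (R : realType) (Omega K : set R) (h : R -> R) :
  open Omega -> closed K -> K `<=` Omega ->
  (forall x, Omega x -> {for x, continuous h}) ->
  (forall x, ~ K x -> h x = 0) -> continuous (h \_ Omega).
Proof.
move=> oO cK KO ch h0 x.
have [Ox|nOx] := pselect (Omega x).
  rewrite /continuous_at patchE mem_set//; apply: cvg_trans (ch x Ox).
  apply: near_eq_cvg; apply: filterS (open_nbhs_nbhs (conj oO Ox)) => y Oy.
  by rewrite patchE mem_set.
rewrite /continuous_at patchE memNset//.
have nK : (~` K) x by move/KO.
have c0 : (fun=> 0 : R) @ x --> (0 : R) by exact: cvg_cst.
apply: cvg_trans c0.
apply: near_eq_cvg.
apply: filterS (open_nbhs_nbhs (conj (closed_openC cK) nK)) => y nKy.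
by rewrite patchE; case: ifPn => // _; rewrite h0.
Qed.

(** Extended by zero, [h] becomes continuously differentiable on the line, so the fundamental
    theorem of calculus applies on a segment [[-N, N]] at whose ends it vanishes, whatever the shape
    of [Omega]. *)
Lemma integral_derivative_compact_support (R : realType) (Omega K : set R)
    (h dh : R -> R) :
  open Omega -> compact K -> K `<=` Omega ->
  (forall x, Omega x -> is_derive x 1 h (dh x)) ->
  (forall x, Omega x -> {for x, continuous dh}) ->
  (forall x, ~ K x -> h x = 0) -> (forall x, ~ K x -> dh x = 0) ->
  \int[lebesgue_measure]_(x in Omega) dh x = 0.
Proof.
move=> oO cK KO dhO cdh h0 dh0.
have clK : closed K by exact: (compact_closed (@Rhausdorff R)).
have [M [Mr hM]] := compact_bounded cK.
(* The margin 1 keeps [K] strictly inside []-N, N[], so that the extension vanishes at both ends. *)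
pose N := `|M| + 1.
have N0 : - N < N by rewrite /N; have := normr_ge0 M; lra.
have KN x : K x -> - N < x < N.
  move=> Kx; rewrite -ltr_norml (@le_lt_trans _ _ (`|M| + 2^-1))//.
    by apply: hM => //; rewrite (le_lt_trans (ler_norm M))// ltrDl.
  by rewrite /N; lra.
have nKN x : ~ (- N < x < N) -> ~ K x by move=> + /KN.
have dH := is_derive_extension oO clK KO dhO h0 dh0.
have cD := continuous_extension oO clK KO cdh dh0.
have cH : continuous (h \_ Omega).
  by apply: continuous_derivable => x; have [] := dH x.
have H0 x : ~ (- N < x < N) -> (h \_ Omega) x = 0.
  by move=> /nKN nK; rewrite patchE h0// if_same.
have -> : \int[lebesgue_measure]_(x in Omega) dh x =
          \int[lebesgue_measure]_(x in `[- N, N]) (dh \_ Omega) x.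
  rewrite Rintegral_mkcond [RHS]Rintegral_mkcond; apply: eq_Rintegral => x _.
  rewrite [RHS]patchE; case: ifPn => // /negP; rewrite inE/= in_itv/= => nx.
  rewrite patchE dh0 ?if_same//; apply: nKN; apply: contra_not nx.
  by move=> /andP[? ?]; rewrite !ltW.
transitivity (fine (((h \_ Omega) N)%:E - ((h \_ Omega) (- N))%:E)).
  congr fine; apply: continuous_FTC2; [exact: N0|exact: continuous_subspaceT| |].
  - split; [|exact/cvg_at_right_filter/cH|exact/cvg_at_left_filter/cH].
    by move=> x _; have [] := dH x.
  - by move=> x _; rewrite derive1E; have /@derive_val := dH x.
by rewrite !H0; [exact: subrr|rewrite ltxx|rewrite ltxx andbF].
Qed.

Lemma integration_by_parts_test (R : realType) (Omega : set R) (w dw phi : R -> R) :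
  open Omega -> test_function Omega phi ->
  (forall x, Omega x -> is_derive x 1 w (dw x)) ->
  (forall x, Omega x -> {for x, continuous dw}) ->
  \int[lebesgue_measure]_(x in Omega) (w x * derive1 phi x) =
  - \int[lebesgue_measure]_(x in Omega) (dw x * phi x).
Proof.
move=> oO tphi dwO cdw; have [_ cK KO] := tphi.
have cw x : Omega x -> {for x, continuous w}.
  by move=> /dwO[d _]; exact/differentiable_continuous/derivable1_diffP.
have cphi := test_function_continuous tphi.
have cdphi := test_function_continuous_derive1 tphi.
have phi0 x := @notin_support_eq0 _ phi x.
have dphi0 x := @notin_support_derive1_eq0 _ phi x.
apply/eqP; rewrite -addr_eq0 -RintegralD; last 3 first.
- exact: open_measurable.
- by apply: integrable_compact_support cK KO _ => //; exact: continuous_locally_integrable.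
- by apply: integrable_compact_support cK KO _ => //; exact: continuous_locally_integrable.
apply/eqP; apply: (integral_derivative_compact_support (h := fun x => w x * phi x)) cK KO _ _ _ _ => //.
- move=> x Ox; have dphi : is_derive x 1 phi (derive1 phi x).
    by rewrite derive1E; exact/derivableP/test_function_derivable/tphi.
  apply: is_derive_eq (is_deriveM (dwO x Ox) dphi) _.
  by rewrite /GRing.scale/= [phi x * _]mulrC.
- move=> x Ox; apply: cvgD; apply: cvgM; [exact: cw|exact: cdphi|exact: cdw|exact: cphi].
- by move=> x nK; rewrite phi0// mulr0.
- by move=> x nK; rewrite phi0// dphi0// !mulr0 addr0.
Qed.

(** * Rigidity of the flux *)

Lemma ae_le_Rintegral d (T : measurableType d) (R : realType)
    (mu : {measure set T -> \bar R}) (D : set T) (f g : T -> R) :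
  measurable D -> mu.-integrable D (EFin \o f) -> mu.-integrable D (EFin \o g) ->
  {ae mu, forall x, D x -> f x <= g x} ->
  \int[mu]_(x in D) f x <= \int[mu]_(x in D) g x.
Proof.
move=> mD fi gi fg; rewrite -subr_ge0 -RintegralB//.
have mfg : measurable_fun D (fun x => g x - f x).
  by apply: measurable_funB; apply/measurable_EFinP;
    [exact: measurable_int gi|exact: measurable_int fi].
(* Almost everywhere on [D], [g - f] equals its absolute value, whose integral is nonnegative. *)
suff -> : \int[mu]_(x in D) (g x - f x) = \int[mu]_(x in D) `|g x - f x|.
  exact: Rintegral_ge0.
congr fine; apply: ae_eq_integral => //.
- exact/measurable_EFinP.
- by apply/measurable_EFinP; exact: measurableT_comp.
- by apply: filterS fg => x fg Dx; rewrite ger0_norm// subr_ge0 fg.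
Qed.

Lemma lebesgue_ae_impl (R : realType) (P Q : R -> Prop) :
  {ae lebesgue_measure, forall x : R, P x} -> (forall x, P x -> Q x) ->
  {ae lebesgue_measure, forall x : R, Q x}.
Proof.
move=> Pae PQ.
have F := ae_filter_ringOfSetsType (@lebesgue_measure R).
exact: (@filterS _ _ F _ _ PQ Pae).
Qed.

(** Testing [z' = -g] against the bump turns the integral into that of [z phi'], which is at most
    the integral of [|phi'|] because [|z| <= 1]. *)
Lemma flux_bump_le2 (R : realType) (Omega : set R) (z g : R -> R) (k a b : R) :
  open Omega -> has_weak_derivative Omega z (fun x => - g x) ->
  {ae lebesgue_measure, forall x : R, Omega x -> `|z x| <= 1} ->
  0 < k -> a < b -> `[a, b] `<=` Omega ->
  \int[lebesgue_measure]_(x in Omega) (g x * smooth_bump k a b x) <= 2.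
Proof.
move=> oO [lz lg wd] z1 k0 ab abO.
have tb := bump_test k0 ab abO; have [_ cK KO] := tb.
have mO : measurable Omega := open_measurable oO.
have cdb := @continuous_derive1_bump R k a b.
have d0 x := @notin_support_derive1_eq0 _ (smooth_bump k a b) x.
have -> : \int[lebesgue_measure]_(x in Omega) (g x * smooth_bump k a b x) =
    \int[lebesgue_measure]_(x in Omega) (z x * derive1 (smooth_bump k a b) x).
  rewrite wd// -mulN1r -RintegralZl//; last first.
    apply: integrable_compact_support cK KO _ => //.
      exact: test_function_continuous tb.
    by move=> x; exact: notin_support_eq0.
  by apply: eq_Rintegral => x _; rewrite mulN1r mulNr opprK.
apply: le_trans (bump_int k0 ab).
have cabs : continuous (fun x => `|derive1 (smooth_bump k a b) x|).
  by move=> x; apply: continuous_comp; [exact: cdb|exact: norm_continuous].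
have abs0 x : ~ closure [set x | smooth_bump k a b x != 0] x ->
    `|derive1 (smooth_bump k a b) x| = 0 by move=> /d0 ->; rewrite normr0.
have -> : \int[lebesgue_measure]_(x in `[a, b]) `|derive1 (smooth_bump k a b) x| =
    \int[lebesgue_measure]_(x in Omega) `|derive1 (smooth_bump k a b) x|.
  rewrite -(setIidr abO) Rintegral_mkcondr; apply: eq_Rintegral => x _.
  rewrite patchE; case: ifPn => // /negP; rewrite inE/= in_itv/= => nx.
  rewrite derive1_bump_out ?normr0//; apply/negP; apply: contra_not nx.
  by move=> /andP[? ?]; rewrite !ltW.
apply: ae_le_Rintegral => //.
- exact: integrable_compact_support cK KO d0.
- rewrite (_ : _ \o _ = (fun x => (1 * `|derive1 (smooth_bump k a b) x|)%:E)); last first.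
    by apply/funext => x /=; rewrite mul1r.
  apply: (integrable_compact_support (g := fun=> 1)) cK KO abs0 => //.
  by apply: continuous_locally_integrable => // x _; exact: cvg_cst.
- apply: (lebesgue_ae_impl z1) => x zx Ox; apply: le_trans (ler_norm _) _.
  by rewrite normrM ler_piMl// zx.
Qed.

(** Two scales are kept apart: [d0] fixes the segment on which the excess [g - m] is measured, while
    [d] can tend to 0 to bring the contribution of the constant [m] up to [m (b - a)]. The bump
    lives on [[a + d, b - d]] and is at least [1 - d] on [[a + 2d, b - 2d]]. *)
Lemma flux_gap (R : realType) (Omega : set R) (z g : R -> R) (m a b d0 d : R) :
  open Omega -> has_weak_derivative Omega z (fun x => - g x) ->
  {ae lebesgue_measure, forall x : R, Omega x -> `|z x| <= 1} ->
  `]a, b[ `<=` Omega -> 0 <= m ->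
  {ae lebesgue_measure, forall x : R, Omega x -> m <= g x} ->
  0 < d -> d <= d0 -> d < 1 -> 4 * d < b - a ->
  lebesgue_measure.-integrable `[a + 2 * d0, b - 2 * d0] (fun x => `|g x - m|%:E) /\
  (1 - d) * (\int[lebesgue_measure]_(x in `[(a + 2 * d0), (b - 2 * d0)]) `|g x - m|
             + m * (b - a - 4 * d)) <= 2.
Proof.
move=> oO wd z1 abO m0 gm dp dd0 d1 dab.
set K : set R := `[a + 2 * d0, b - 2 * d0]%classic.
pose K' : set R := `[a + 2 * d, b - 2 * d]%classic.
have a'b' : a + d < b - d by lra.
have sO : `[a + d, b - d] `<=` Omega.
  by apply: subset_trans abO => x /=; rewrite !in_itv/= => /andP[? ?]; apply/andP; split; lra.
have KK' : K `<=` K'.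
  by move=> x; rewrite /K /K'/= !in_itv/= => /andP[? ?]; apply/andP; split; lra.
have K's : K' `<=` `[a + d, b - d].
  by move=> x; rewrite /K'/= !in_itv/= => /andP[? ?]; apply/andP; split; lra.
have K'O : K' `<=` Omega by apply: subset_trans sO.
have KO : K `<=` Omega by apply: subset_trans K'O.
have mO : measurable Omega := open_measurable oO.
have mK : measurable K by exact: measurable_itv.
have mK' : measurable K' by exact: measurable_itv.
have k0 : 0 < d ^- 3 by rewrite invr_gt0 exprn_gt0.
have bound := flux_bump_le2 oO wd z1 k0 a'b' sO.
have tb := bump_test k0 a'b' sO; have [_ cS SO] := tb.
have [_ lNg _] := wd.
have lg : locally_integrable Omega g.
  rewrite (_ : g = \- (fun x => - g x))%R; first exact: locally_integrableN.
  by apply/funext => x /=; rewrite opprK.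
have lgm : locally_integrable Omega (fun x => g x - m).
  apply: (locally_integrableB lg (g := fun=> m)).
  by apply: continuous_locally_integrable => // x _; exact: cvg_cst.
have igK : lebesgue_measure.-integrable K (fun x => `|g x - m|%:E).
  case: lgm => mg _ /(_ K KO (@segment_compact _ _ _)) igm.
  apply/integrableP; split.
    apply/measurable_EFinP; apply: measurableT_comp => //.
    exact: measurable_funS mg.
  by under eq_integral do rewrite /= normr_id.
split=> //.
have imK' : lebesgue_measure.-integrable K' (fun x => m%:E).
  apply: (@continuous_compact_integrable _ (fun=> m)); first exact: segment_compact.
  by apply: continuous_subspaceT => x; exact: cvg_cst.
have i1 : lebesgue_measure.-integrable Omega (EFin \o ((fun x => `|g x - m|) \_ K)).
  by rewrite -restrict_EFin; apply/integrable_restrict => //; rewrite setIidr.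
have i2 : lebesgue_measure.-integrable Omega (EFin \o ((fun=> m) \_ K')).
  by rewrite -restrict_EFin; apply/integrable_restrict => //; rewrite setIidr.
have -> : m * (b - a - 4 * d) = \int[lebesgue_measure]_(x in K') m.
  rewrite Rintegral_cst//; congr (_ * _).
  have /= := lebesgue_measure_itv `[a + 2 * d, b - 2 * d]%R.
  by rewrite lte_fin ifT; [move=> ->; rewrite -EFinB/=; ring|lra].
have -> : \int[lebesgue_measure]_(x in K) `|g x - m| =
    \int[lebesgue_measure]_(x in Omega) ((fun x => `|g x - m|) \_ K) x.
  by rewrite -Rintegral_mkcondr setIidr.
have -> : \int[lebesgue_measure]_(x in K') m =
    \int[lebesgue_measure]_(x in Omega) ((fun=> m) \_ K') x.
  by rewrite -Rintegral_mkcondr setIidr.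
have i12 : lebesgue_measure.-integrable Omega (EFin \o
    (fun x => ((fun x => `|g x - m|) \_ K) x + ((fun=> m) \_ K') x)).
  by apply: (integrableD _ i1 i2).
rewrite -RintegralD// -RintegralZl//.
apply: le_trans bound; apply: ae_le_Rintegral => //.
- by apply: (integrableZl _ (1 - d) i12).
- apply: integrable_compact_support cS SO _ => //.
    exact: test_function_continuous tb.
  by move=> x; exact: notin_support_eq0.
(* Pointwise comparison in three zones: on [K] the two terms add up to [g]; on [K'] outside [K] only
   [m <= g] remains; off [K'] the left side is 0. *)
- apply: (lebesgue_ae_impl gm) => x gx Ox; have {}gx := gx Ox.
  have b0 := bump_ge0 (d ^- 3) (a + d) (b - d) x.
  rewrite !patchE; case: ifPn => [/set_mem xK|_].
    have xK' := KK' _ xK; rewrite mem_set// ger0_norm ?subr_ge0// subrK mulrC.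
    rewrite ler_wpM2l ?(le_trans m0 gx)// bump_ge//.
    by move: xK'; rewrite /K'/= in_itv/= => /andP[? ?]; apply/andP; split; lra.
  rewrite add0r; case: ifPn => [/set_mem xK'|_]; last first.
    by rewrite mulr0 mulr_ge0// (le_trans m0 gx).
  rewrite mulrC ler_pM//; first by lra.
  rewrite bump_ge//.
  by move: xK'; rewrite /K'/= in_itv/= => /andP[? ?]; apply/andP; split; lra.
Qed.

(** The constant part [m (b - a) = 2] already exhausts the bound of [flux_gap] as [d] tends to 0,
    which leaves no room for an excess of [g] over [m]. *)
Lemma flux_rigidity (R : realType) (Omega : set R) (z g : R -> R) (m a b : R) :
  open Omega -> has_weak_derivative Omega z (fun x => - g x) ->
  {ae lebesgue_measure, forall x : R, Omega x -> `|z x| <= 1} ->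
  `]a, b[ `<=` Omega -> a < b -> 0 <= m -> m * (b - a) = 2 ->
  {ae lebesgue_measure, forall x : R, Omega x -> m <= g x} ->
  {ae lebesgue_measure, forall x : R, `]a, b[ x -> g x = m}.
Proof.
move=> oO wd z1 abO ab m0 mab gm.
pose K (n : nat) := `[a + 2 * n.+1%:R^-1, b - 2 * n.+1%:R^-1]%classic.
suff gK n : {ae lebesgue_measure, forall x : R, K n x -> g x = m}.
  apply: (lebesgue_ae_impl (ae_foralln gK)) => x gx; rewrite /= in_itv/= => /andP[ax xb].
  (* The segments [K n] exhaust []a, b[]: [x] lies in [K n] once [1 / (n+1)] is below half its
     distance to the endpoints. *)
  have : 0 < Num.min (x - a) (b - x) / 2.
    by rewrite divr_gt0// lt_min !subr_gt0 ax.
  move=> /ltr_add_invr[n]; rewrite add0r ltr_pdivlMr// lt_min => /andP[h1 h2].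
  apply: (gx n); rewrite /K/= in_itv/=; move: (n.+1%:R^-1) h1 h2 => e h1 h2.
  by apply/andP; split; lra.
pose d0 : R := n.+1%:R^-1; have d00 : 0 < d0 by rewrite invr_gt0 ltr0n.
pose J := \int[lebesgue_measure]_(x in K n) `|g x - m|.
have J0 : 0 <= J by exact: Rintegral_ge0.
have gap d := @flux_gap _ Omega z g m a b d0 d oO wd z1 abO m0 gm.
have J_le0 : J <= 0.
  rewrite leNgt; apply/negP => Jp.
  (* [C] is minus the coefficient of [d] when [(1 - d) (J + 2 - 4md)] is expanded. Taking
     [d C <= J / 2] keeps the product at least [2 + J / 2], against the bound 2. *)
  pose C := 4 * m + J + 2; have C0 : 0 < C by rewrite /C; lra.
  pose d := Num.min (Num.min d0 2^-1) (Num.min ((b - a) / 8) (J / (2 * C))).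
  have dp : 0 < d by rewrite !lt_min d00 !divr_gt0 ?subr_gt0 ?mulr_gt0// invr_gt0 ltr0n.
  have : d <= d by []; rewrite {2}/d !le_min => /andP[/andP[h1 h2] /andP[h3 h4]].
  have [//|//|||_] := gap d; [by lra|by lra|].
  rewrite -/(K n) -/J; move: h4; rewrite ler_pdivlMr ?mulr_gt0// => h4.
  have -> : m * (b - a - 4 * d) = 2 - 4 * m * d by rewrite mulrBr mab; ring.
  have -> : (1 - d) * (J + (2 - 4 * m * d)) =
      J + 2 - d * C + 4 * m * d ^+ 2 by rewrite /C; ring.
  have : 0 <= 4 * m * d ^+ 2 by rewrite mulr_ge0 ?sqr_ge0// mulr_ge0.
  have : d * (2 * C) = 2 * (d * C) by ring.
  lra.
have Je : J = 0 by apply/eqP; rewrite eq_le J_le0.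
(* Any admissible [d] serves here: [flux_gap] is called again for the integrability of [|g - m|] on
   [K n]. *)
pose d := Num.min (Num.min d0 2^-1) ((b - a) / 8).
have dp : 0 < d by rewrite !lt_min d00 divr_gt0 ?subr_gt0// invr_gt0 ltr0n.
have : d <= d by []; rewrite {2}/d !le_min => /andP[/andP[h1 h2] h3].
have [//|//|||iK _] := gap d; [by lra|by lra|].
have aeK := @ae_eq_integral_abs _ _ _ (@lebesgue_measure R) (K n)
  (measurable_itv _) _ (measurable_int _ iK).
have /aeK/lebesgue_ae_impl : (\int[lebesgue_measure]_(x in K n) `| `|g x - m|%:E | = 0)%E.
  under eq_integral do rewrite /= normr_id.
  rewrite -[LHS]fineK; last first.
    exact: (integrable_fin_num _ iK).
  exact: (congr1 EFin Je).
by apply => x gx /gx/(congr1 fine)/= /normr0_eq0/subr0_eq.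
Qed.

(** * The zero charge as distributional derivative *)

Lemma czero_hahn (R : realType) : hahn_decomposition
  (czero : {charge set (measurableTypeR R) -> \bar R}) setT set0.
Proof.
split.
- by split=> [|A _ _]; [exact: measurableT|exact: lexx].
- by split=> [|A _ _]; [exact: measurable0|exact: lexx].
- by rewrite setU0.
- by rewrite setI0.
Qed.

Lemma czero_jordan (R : realType) (A : set (measurableTypeR R)) :
  jordan_pos (czero_hahn R) A = 0%E /\ jordan_neg (czero_hahn R) A = 0%E.
Proof.
rewrite jordan_posE cjordan_posE jordan_negE cjordan_negE /crestr0 /crestr.
by rewrite !if_same oppe0.
Qed.

Lemma Rintegral_null_measure d (T : measurableType d) (R : realType)
    (mu : {measure set T -> \bar R}) (D : set T) (f : T -> R) :
  (forall A, mu A = 0%E) -> \int[mu]_(x in D) f x = 0.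
Proof.
move=> mu0; rewrite /Rintegral.
suff -> : (\int[mu]_(x in D) (f x)%:E = \int[mzero]_(x in D) (f x)%:E)%E.
  by rewrite integral_measure_zero.
by apply: eq_measure_integral => A _ _; rewrite mu0.
Qed.

Lemma charge_Rintegral_czero (R : realType) (D : set R) (phi : R -> R) :
  charge_Rintegral (czero_hahn R) D phi = 0.
Proof.
rewrite /charge_Rintegral.
have p0 : \int[jordan_pos (czero_hahn R)]_(x in D) phi x = 0.
  by apply: Rintegral_null_measure => A; have [] := czero_jordan A.
have n0 : \int[jordan_neg (czero_hahn R)]_(x in D) phi x = 0.
  by apply: Rintegral_null_measure => A; have [] := czero_jordan A.
by rewrite p0 n0 subrr.
Qed.

Lemma Rintegral_czero_variation (R : realType) (D : set R) (phi : R -> R) :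
  \int[charge_variation (czero_hahn R)]_(x in D) phi x = 0.
Proof.
apply: Rintegral_null_measure => A; have [p0 n0] := czero_jordan A.
transitivity (jordan_pos (czero_hahn R) A + jordan_neg (czero_hahn R) A)%E => //.
by rewrite p0 n0 adde0.
Qed.

(** * Construction of a solution supported in one component *)

Lemma near_const_continuous (R : realType) (h : R -> R) (x : R) :
  (\forall y \near x, h y = h x) -> {for x, continuous h}.
Proof.
move=> hx; have c0 : (fun=> h x : R) @ x --> h x by exact: cvg_cst.
by apply: cvg_trans c0; apply: near_eq_cvg; apply: filterS hx.
Qed.

Lemma near_const_is_derive (R : realType) (h : R -> R) (x : R) :
  (\forall y \near x, h y = h x) -> is_derive x 1 h 0.
Proof.
by move=> hx; apply: near_eq_is_derive (is_derive_cst (h x) x 1); apply: filterS hx.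
Qed.

(** Traces are read off from a function [w] continuous at the endpoint that agrees with [v] inside
    the interval; [v] itself may jump there. *)
Lemma right_trace_continuous (R : realType) (v w : R -> R) (a b : R) : a < b ->
  (forall x, a < x < b -> v x = w x) -> {for a, continuous w} ->
  right_trace v a (w a).
Proof.
move=> ab vw /cvgrPdist_lt cw e /cw[d /= d0 dw].
exists (Num.min d (b - a)); first by rewrite lt_min d0 subr_gt0.
apply: aeW => x /andP[ax]; rewrite -ltrBlDl lt_min => /andP[xd xb].
rewrite vw; last by rewrite ax; lra.
by rewrite distrC; apply: dw; rewrite /= distrC gtr0_norm// subr_gt0.
Qed.

Lemma left_trace_continuous (R : realType) (v w : R -> R) (a b : R) : a < b ->
  (forall x, a < x < b -> v x = w x) -> {for b, continuous w} ->
  left_trace v b (w b).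
Proof.
move=> ab vw /cvgrPdist_lt cw e /cw[d /= d0 dw].
exists (Num.min d (b - a)); first by rewrite lt_min d0 subr_gt0.
apply: aeW => x /andP[]; rewrite ltrBlDl -ltrBlDr lt_min => /andP[xd xa] xb.
rewrite vw; last by rewrite xb; lra.
by rewrite distrC; apply: dw; rewrite /= gtr0_norm// subr_gt0.
Qed.

Lemma bounded_finite_measure (R : realType) (Omega : set R) :
  bounded_set Omega -> measurable Omega -> (lebesgue_measure Omega < +oo)%E.
Proof.
move=> [M [_ hM]] mO.
apply: (@le_lt_trans _ _ (lebesgue_measure `[- (`|M| + 1), `|M| + 1]%classic)).
  apply: le_measure; rewrite ?inE; [exact: mO|exact: measurable_itv|].
  move=> x Ox; rewrite /= in_itv/= -ler_norml; apply: (hM _ _ x Ox).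
  by rewrite (le_lt_trans (ler_norm M))// ltrDl.
rewrite lebesgue_measure_itv/=; case: ifP => // _.
by rewrite -EFinB ltry.
Qed.

Lemma solution_one_component (R : realType) (Omega : set R) (I : set nat)
    (a b : nat -> R) (f : R -> R) (lam c0 : R) (n0 : nat) :
  bounded_set Omega -> open Omega -> (forall n, I n -> a n < b n) ->
  trivIset I (fun n => `]a n, b n[) -> Omega = \bigcup_(n in I) `]a n, b n[ ->
  I n0 -> 0 < c0 -> 0 < lam -> 0 <= f 0 -> 0 <= f c0 ->
  lam * f c0 * (b n0 - a n0) = 2 ->
  (forall n, I n -> lam * f 0 * (b n - a n) <= 2) ->
  solution Omega I a b f lam (fun x => if a n0 < x < b n0 then c0 else 0).
Proof.
move=> bO oO ab dj OE In0 c00 lam0 f00 fc0 fc0E f0E.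
set u := fun x => _.
(* On the component [n], [s n] is the value of [u] and [- q n] the slope of [z]. [idx x] is the
   component containing [x], with an arbitrary value outside [Omega]. *)
pose s n := if n == n0 then c0 else 0.
pose q n := lam * f (s n).
pose idx x := xget 0%N [set n | I n /\ a n < x < b n].
pose z x := - q (idx x) * (x - (a (idx x) + b (idx x)) / 2).
have inO n x : I n -> a n < x < b n -> Omega x.
  by move=> In xn; rewrite OE; exists n => //=; rewrite in_itv.
have Oin x : Omega x -> exists n, I n /\ a n < x < b n.
  by rewrite OE => -[n In]; rewrite /= in_itv/=; exists n.
have uniq n m x : I n -> I m -> a n < x < b n -> a m < x < b m -> n = m.
  by move=> In Im xn xm; apply: dj => //; exists x; split; rewrite /= in_itv.
have idxE n x : I n -> a n < x < b n -> idx x = n.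
  move=> In xn; apply: xget_unique => // m [Im xm]; exact: uniq xm xn.
have uE n x : I n -> a n < x < b n -> u x = s n.
  move=> In xn; rewrite /u /s; case: ifPn => xn0.
    by rewrite (uniq _ _ _ In In0 xn xn0) eqxx.
  by case: eqP => // nn0; move: xn0; rewrite -nn0 xn.
have zE n x : I n -> a n < x < b n -> z x = - q n * (x - (a n + b n) / 2).
  by move=> In xn; rewrite /z (idxE n).
have s0 n : 0 <= s n by rewrite /s; case: ifP => // _; exact: ltW.
have fs0 n : 0 <= f (s n) by rewrite /s; case: ifP.
have q0 n : 0 <= q n by rewrite /q mulr_ge0// ltW.
have qle n : I n -> q n * (b n - a n) <= 2.
  by move=> In; rewrite /q /s; case: eqP => [->|_]; [rewrite fc0E|exact: f0E].
have near_comp n x : I n -> a n < x < b n -> \forall y \near x, a n < y < b n.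
  move=> In xn; have : nbhs x `]a n, b n[.
    by apply: open_nbhs_nbhs; split; [exact: itv_open|rewrite /= in_itv].
  by apply: filterS => y; rewrite /= in_itv.
have near_u x : Omega x -> \forall y \near x, u y = u x.
  (* Local constancy of [u] on [Omega] yields [u' = 0] and makes [f \o u] continuous there, with no
     appeal to continuity of [f]. *)
  move=> /Oin[n [In xn]]; apply: filterS (near_comp n x In xn) => y yn.
  by rewrite !(uE n).
pose dz x := - (lam * f (u x)).
have du x : Omega x -> is_derive x 1 u 0 by move=> /near_u; exact: near_const_is_derive.
have cu x : Omega x -> {for x, continuous u}.
  by move=> /near_u; exact: near_const_continuous.
have cdz x : Omega x -> {for x, continuous dz}.
  by move=> /near_u h; apply: near_const_continuous; apply: filterS h => y; rewrite /dz => ->.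
have cfu x : Omega x -> {for x, continuous (f \o u)}.
  by move=> /near_u h; apply: near_const_continuous; apply: filterS h => y /= ->.
have dzP x : Omega x -> is_derive x 1 z (dz x).
  move=> /Oin[n [In xn]].
  apply: (@near_eq_is_derive _ _ _ (horner (- q n *: ('X - ((a n + b n) / 2)%:P)))).
    apply: filterS (near_comp n x In xn) => y yn.
    by rewrite (zE n)// hornerZ hornerXsubC.
  apply: is_derive_eq (is_derive_poly _ _) _.
  by rewrite derivZ derivXsubC hornerZ hornerC mulr1 /dz (uE n).
have cz x : Omega x -> {for x, continuous z}.
  by move=> /dzP[d _]; exact/differentiable_continuous/derivable1_diffP.
have mO : measurable Omega := open_measurable oO.
have fO := bounded_finite_measure bO mO.
split; first by apply: aeW => x /Oin[n [In xn]]; rewrite (uE n).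
split.
  apply: measurable_bounded_integrable => //.
    by apply: open_continuous_measurable_fun => // x /set_mem; exact: cu.
  exists c0; split; first exact: num_real.
  move=> M cM x _ /=; rewrite /u; case: ifP => _.
    by rewrite ger0_norm ltW.
  by rewrite normr0 ltW// (lt_trans c00).
split.
  split; first by apply: open_continuous_measurable_fun => // x /set_mem; exact: cfu.
  (* [M] bounds [f(u)]: superlevel sets are empty for [k >= M], and for [k < M] the product is at
     most [M] times the finite measure of [Omega]. *)
  pose M := Num.max (f c0) (f 0).
  exists (M * fine (lebesgue_measure Omega)) => k k0.
  have M0 : 0 <= M by rewrite /M le_max fc0.
  have [kM|Mk] := ltP k M; last first.
    rewrite (_ : _ `&` _ = set0) ?measure0 ?mule0 ?lee_fin ?mulr_ge0 ?fine_ge0//.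
    apply/seteqP; split => // x [Ox] /=; apply/negP; rewrite -leNgt.
    apply: le_trans Mk; rewrite /M /u; case: ifP => _; rewrite ger0_norm//.
      by rewrite le_max lexx.
    by rewrite le_max lexx orbT.
  rewrite EFinM fineK ?ge0_fin_numE// lee_pmul//.
  - by rewrite lee_fin ltW.
  - by rewrite lee_fin ltW.
  - apply: le_measure; rewrite ?inE; [|exact: mO|exact: subIsetl].
    rewrite (_ : _ `&` _ = Omega `&` (fun x => `|f (u x)|) @^-1` `]k, +oo[%classic); last first.
      by congr (_ `&` _); apply/funext => x /=; rewrite in_itv/= andbT.
    have : measurable_fun Omega (fun x => `|f (u x)|).
      apply: measurableT_comp => //.
      by apply: open_continuous_measurable_fun => // x /set_mem; exact: cfu.
    by apply => //; exact: measurable_itv.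
exists czero, setT, set0, (czero_hahn R); split.
  move=> phi tphi; rewrite charge_Rintegral_czero.
  rewrite (@integration_by_parts_test _ _ _ (fun=> 0) _ oO tphi du); last first.
    by move=> x _; exact: cvg_cst.
  under eq_Rintegral do rewrite mul0r.
  by rewrite Rintegral_cst// mul0r.
exists z; split.
- split; first by apply: open_continuous_measurable_fun => // x /set_mem; exact: cz.
  apply: aeW => x /Oin[n [In xn]]; rewrite (zE n)// normrM normrN (ger0_norm (q0 n)).
  have h : `|x - (a n + b n) / 2| <= (b n - a n) / 2.
    by rewrite ler_norml; move: xn => /andP[? ?]; apply/andP; split; lra.
  have := qle n In; have := ler_wpM2l (q0 n) h; lra.
- split; [exact: continuous_locally_integrable|exact: continuous_locally_integrable|].
  by move=> phi tphi; exact: integration_by_parts_test.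
- move=> phi tphi; rewrite Rintegral_czero_variation /pairing.
  (* As [|Du| = 0], the pairing has to vanish; this is integration by parts for [u z], whose
     derivative is [u z'] since [u' = 0]. *)
  have duz x : Omega x -> is_derive x 1 (fun x => u x * z x) (u x * dz x).
    move=> Ox; apply: is_derive_eq (is_deriveM (du x Ox) (dzP x Ox)) _.
    by rewrite scaler0 addr0.
  rewrite (integration_by_parts_test oO tphi duz); last first.
    by move=> x Ox; apply: cvgM; [exact: cu|exact: cdz].
  rewrite opprK addrC; apply/eqP; rewrite subr_eq0; apply/eqP.
  by apply: eq_Rintegral => x _; rewrite mulrAC.
- move=> n In; have abn := ab n In.
  pose w x := - q n * (x - (a n + b n) / 2).
  have cw : continuous w.
    move=> x; apply: cvgM; first exact: cvg_cst.
    by apply: cvgB; [exact: cvg_id|exact: cvg_cst].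
  have wa : w (a n) = q n * (b n - a n) / 2 by rewrite /w; field.
  have wb : w (b n) = - (q n * (b n - a n) / 2) by rewrite /w; field.
  (* One membership serves both endpoints, since [z] times the outward normal is
     [- q n (b n - a n) / 2] at each. It equals -1 on the component [n0]; elsewhere [u] has trace 0
     and a value in [[-1, 1]] suffices. *)
  have sgn : msign (- s n) (- (q n * (b n - a n) / 2)).
    rewrite /msign oppr_eq0; have := qle n In.
    have : 0 <= q n * (b n - a n) by rewrite mulr_ge0// subr_ge0 ltW.
    have [->|nn0] := eqVneq n n0.
      rewrite /q /s eqxx fc0E gt_eqF//= normrN gtr0_norm// mulNr !divff ?gt_eqF//.
    by rewrite /s (negbTE nn0) eqxx/= in_itv/=; move=> ? ?; apply/andP; split; lra.
  split.
    exists (s n), (w (a n)); split.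
    + apply: (@right_trace_continuous _ u (fun=> s n) _ _ abn) => [x|]; first exact: uE.
      exact: cvg_cst.
    + by apply: right_trace_continuous abn _ (cw _) => x xn; exact: zE.
    + by rewrite mulrN1 wa.
  exists (s n), (w (b n)); split.
  + apply: (@left_trace_continuous _ u (fun=> s n) _ _ abn) => [x|]; first exact: uE.
    exact: cvg_cst.
  + by apply: left_trace_continuous abn _ (cw _) => x xn; exact: zE.
  + by rewrite mulr1 wb.
Qed.

(** * Nontriviality, choice of the constant, and conclusion *)

Lemma component_ae_neq0 (R : realType) (Omega : set R) (a b c : R) : a < b ->
  0 < c -> `]a, b[ `<=` Omega ->
  ~ {ae lebesgue_measure, forall x : R, Omega x ->
      (if a < x < b then c else 0) = 0}.
Proof.
move=> ab c0 abO [N [mN N0 sub]].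
have : (lebesgue_measure `]a, b[%classic <= lebesgue_measure N)%E.
  apply: le_measure; rewrite ?inE; [exact: measurable_itv|exact: mN|].
  move=> x xab; apply: sub => /= /(_ (abO _ xab)).
  by move: xab; rewrite /= in_itv/= => ->; apply/eqP; rewrite gt_eqF.
have /= -> := lebesgue_measure_itv `]a, b[%R.
by rewrite N0 lte_fin ab -EFinB lee_fin leNgt subr_gt0 ab.
Qed.

Lemma continuous_to_infty_attains (R : realType) (f : R -> R) (y : R) :
  {within `[0, +oo[, continuous f} -> f s @[s --> +oo] --> +oo -> f 0 < y ->
  exists2 c : R, 0 < c & f c = y.
Proof.
move=> cf limf fy.
have : \forall s \near +oo, (0 < s) && (y < f s).
  near=> s; apply/andP; split; first by near: s; exact: nbhs_pinfty_gt.
  by near: s; move/cvgryPgt : limf; apply.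
move=> /filter_ex[s /andP[s0 ys]].
have [||c + fcy] := @IVT R f 0 s y (ltW s0).
- apply: continuous_subspaceW cf => x /=; rewrite !in_itv/= andbT.
  by move=> /andP[].
- by rewrite ge_min (ltW fy) le_max (ltW ys) orbT.
- rewrite in_itv/= => /andP[]; rewrite le_eqVlt => /predU1P[c0|c0 _]; last by exists c.
  by move: fy; rewrite c0 fcy ltxx.
Unshelve. all: by end_near. Qed.

Unset Implicit Arguments.
Set Strict Implicit.

Theorem proposition3p2 (R : realType) (Omega : set R) (I : set nat)
    (a b : nat -> R) (L : R) (f : R -> R)
    (Omega_neq0 : Omega !=set0) (Omega_bounded : bounded_set Omega)
    (Omega_open : open Omega)
    (I_index : I = [set: nat] \/ exists k : nat, I = [set n | (1 <= n <= k)%N])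
    (ab : forall n, I n -> a n < b n)
    (Omega_disjoint : trivIset I (fun n => `]a n, b n[))
    (Omega_eq : Omega = \bigcup_(n in I) `]a n, b n[)
    (L_max : [set b n - a n | n in I] L /\ ubound [set b n - a n | n in I] L)
    (f_ge0 : forall s : R, 0 <= s -> 0 <= f s)
    (f_incr : forall s t : R, 0 <= s -> s < t -> f s < f t)
    (f_cont : {within `[0, +oo[, continuous f})
    (f_lim : f s @[s --> +oo] --> +oo)
    (f0_gt0 : 0 < f 0) :
  let lamstar := 2 / (L * f 0) in
  (forall lam : R, 0 < lam -> lam < lamstar ->
     exists u : R -> R,
       [/\ solution Omega I a b f lam u,
           {ae lebesgue_measure, forall x : R, Omega x -> 0 <= u x} &
           ~ {ae lebesgue_measure, forall x : R, Omega x -> u x = 0}]) /\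
  (forall u : R -> R, solution Omega I a b f lamstar u ->
     forall n, I n -> b n - a n = L ->
       {ae lebesgue_measure, forall x : R, `]a n, b n[ x -> u x = 0}).
Proof.
move=> lamstar; have [[n0 In0 n0L] Lub] := L_max.
have L0 : 0 < L by rewrite -n0L subr_gt0 ab.
have compO n : I n -> `]a n, b n[ `<=` Omega.
  by move=> In x xn; rewrite Omega_eq; exists n.
split.
  move=> lam lam0; rewrite ltr_pdivlMr ?mulr_gt0// => lamlt.
  (* The value [2 / (lam * L)] makes [z] drop by exactly 2 across a component of length [L]; it
     exceeds [f 0] precisely because [lam < lamstar]. *)
  have [|c c0 fc] := @continuous_to_infty_attains R f (2 / (lam * L)) f_cont f_lim.
    by rewrite ltr_pdivlMr ?mulr_gt0// mulrC -mulrA.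
  have sol : solution Omega I a b f lam (fun x => if a n0 < x < b n0 then c else 0).
    apply: solution_one_component => //.
    - exact: ltW.
    - exact/f_ge0/ltW.
    - by rewrite fc n0L; field; rewrite !gt_eqF.
    - move=> n In; apply: le_trans (ltW lamlt).
      rewrite -mulrA ler_wpM2l ?(ltW lam0)// mulrC ler_wpM2r ?(ltW f0_gt0)//.
      by apply: Lub; exists n.
  exists (fun x => if a n0 < x < b n0 then c else 0); split => //.
    by case: sol.
  exact: component_ae_neq0 (ab _ In0) c0 (compO _ In0).
move=> u [u0 [_ [_ [Du [P [N [DuPN [_ [z [[_ z1] wd _ _]]]]]]]]]] n In nL.
have lam0 : 0 < lamstar by rewrite divr_gt0// mulr_gt0.
have fu : {ae lebesgue_measure, forall x : R,
    `]a n, b n[ x -> lamstar * f (u x) = lamstar * f 0}.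
  (* Here [m = lamstar * f 0], and the definition of [lamstar] gives [m * L = 2]. Monotonicity of
     [f] on nonnegative values gives the lower bound; its strictness then turns [f (u x) = f 0] into
     [u x = 0]. *)
  apply: (flux_rigidity Omega_open wd z1 (compO n In) (ab n In)).
  - by rewrite mulr_ge0// ltW.
  - by rewrite nL /lamstar; field; rewrite !gt_eqF.
  - apply: (lebesgue_ae_impl u0) => x ux Ox; rewrite ler_wpM2l ?(ltW lam0)//.
    have := ux Ox; rewrite le_eqVlt => /predU1P[<-//|ux0].
    by rewrite ltW// f_incr.
have F := ae_filter_ringOfSetsType (@lebesgue_measure R).
apply: (@filterS2 _ _ F _ _ _ _ u0 fu) => x ux fx xn.
have := ux (compO n In x xn); rewrite le_eqVlt => /predU1P[//|ux0].
have /(mulfI (lt0r_neq0 lam0)) fe := fx xn.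
by have := f_incr 0 (u x) (lexx 0) ux0; rewrite fe ltxx.
Qed.
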